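(* Let $w\in S_n$ have length $\ell$. Then in $\mathcal{K}_+$ $$\mathfrak{S}_w(u_1,u_2-u_1,u_3-u_2,\dots,u_{n-1}-u_{n-2})=\frac{1}{[\ell]_q!}\sum_{\mathbf{a}=a_1\cdots a_\ell\in\mathrm{Red}(w)}q^{\mathrm{comaj}(\mathbf{a})}\,u_{a_1}u_{a_2}\cdots u_{a_\ell}.$$
   Context: Let $\mathbf{k}$ be a field of characteristic zero and $q\in\mathbf{k}$ not a nontrivial root of unity; $[\ell]_q!=\prod_{i=1}^\ell(1+\dots+q^{i-1})$. The Klyachko algebra $\mathcal{K}$ is the commutative $\mathbf{k}$-algebra generated by $u_i$, $i\in\mathbb{Z}$, with relations $(q+1)u_i^2=qu_iu_{i-1}+u_iu_{i+1}$; $\mathcal{K}_+$ is its quotient by the ideal generated by the $u_i$, $i\le0$. $\mathfrak{S}_w$ is the Schubert polynomial: $\mathfrak{S}_{w_0}=x_1^{n-1}x_2^{n-2}\cdots x_{n-1}$ for the longest $w_0\in S_n$, and $\mathfrak{S}_{ws_i}=\partial_i\mathfrak{S}_w$ whenever $w(i)>w(i+1)$, with $\partial_i g=(g-s_ig)/(x_i-x_{i+1})$. $\mathrm{Red}(w)$ is the set of reduced words $a_1\cdots a_\ell$ with $w=s_{a_1}\cdots s_{a_\ell}$, and $\mathrm{comaj}(\mathbf{a})=\sum\{j\in[\ell-1]: a_j<a_{j+1}\}$. *)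

(* Defs.v *)
From HB Require Import structures.
From mathcomp Require Import all_boot all_order all_algebra all_fingroup.
From mathcomp Require Import mpoly.
From Stdlib Require Import ClassicalEpsilon.

Set Implicit Arguments.
Unset Strict Implicit.
Unset Printing Implicit Defensive.

Import Order.TTheory GRing.Theory Num.Theory.
Local Open Scope ring_scope.

Section Klyachko.
Variable k : fieldType.

(* Position i : 'I_n (0-indexed) is the paper's position i+1.
   The simple transposition s_{i+1} of the paper (valid when i.+1 < n)
   swaps positions i and i+1. *)
Definition nextpos n (i : 'I_n) : 'I_n := insubd i i.+1.
Definition sref n (i : 'I_n) : 'S_n := tperm i (nextpos i).

(* Paper's product s_{a_1} ... s_{a_l}, composed as functions
   (right-to-left): x |-> s_{a_1}(s_{a_2}(... s_{a_l}(x))).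
   In mathcomp (s * t) x = t (s x), so this is s_{a_l} * ... * s_{a_1}. *)
Definition wordperm n (a : seq 'I_n) : 'S_n :=
  foldr (fun i acc => (acc * sref i)%g) 1%g a.

Definition perm_length n (w : 'S_n) : nat :=
  #|[set p : 'I_n * 'I_n | (p.1 < p.2)%N && (w p.2 < w p.1)%N]|.

Definition w0 n : 'S_n := perm (@rev_ord_inj n).

Definition comaj n (a : seq 'I_n) : nat :=
  \sum_(j < (size a).-1 | (nth 0%N (map val a) j < nth 0%N (map val a) j.+1)%N)
     j.+1.

(* a is a word in the letters 1..n-1 (0-indexed letter i stands for s_{i+1}). *)
Definition valid_word n (a : seq 'I_n) : bool := all (fun i : 'I_n => i.+1 < n)%N a.

(* Variable 'X_i (i : 'I_n) is the paper's x_{i+1}. *)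
Definition swapvars n (i : 'I_n) (g : {mpoly k[n]}) : {mpoly k[n]} :=
  g \mPo [tuple 'X_(sref i j) | j < n].

(* partial_i g = (g - s_i g)/(x_i - x_{i+1}): the (unique, since the
   polynomial ring is a domain) h with (x_i - x_{i+1}) h = g - s_i g. *)
Definition divdiff n (i : 'I_n) (g : {mpoly k[n]}) : {mpoly k[n]} :=
  epsilon (inhabits 0)
    (fun h : {mpoly k[n]} => ('X_i - 'X_(nextpos i)) * h = g - swapvars i g).

Definition schub_w0 n : {mpoly k[n]} := \prod_(i < n) 'X_i ^+ (n.-1 - i).

(* Recursion S_{w s_i} = partial_i S_w for w(i) > w(i+1):
   for v <> w0 pick an ascent i of v (v(i) < v(i+1)); then w := v s_i
   has a descent at i and S_v = partial_i S_w.  In mathcomp, the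
   composite v s_i (as functions) is  sref i * v. *)
Fixpoint schub_aux n (fuel : nat) (v : 'S_n) : {mpoly k[n]} :=
  match fuel with
  | 0%N => schub_w0 n
  | fuel'.+1 =>
      match [pick i : 'I_n | (i.+1 < n)%N && (v i < v (nextpos i))%N] with
      | Some i => divdiff i (schub_aux fuel' (sref i * v)%g)
      | None => schub_w0 n
      end
  end.

Definition schubert n (w : 'S_n) : {mpoly k[n]} :=
  schub_aux (perm_length (w0 n) - perm_length w) w.

Definition qint (q : k) (i : nat) : k := \sum_(j < i) q ^+ j.
Definition qfact (q : k) (l : nat) : k := \prod_(i < l) qint q i.+1.

(* We work in the polynomial ring over the variables u_i, -M <= i <= M
   (variable index i + M); u_i := 0 outside this window (never used
   outside it below). *)
Definition Kvar (M : nat) (i : int) : {mpoly k[(M + M).+1]} :=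
  if (- (M%:Z) <= i) && (i <= M%:Z) then 'X_(inord (absz (i + M%:Z))) else 0.

Definition Krel (q : k) (M : nat) (i : int) : {mpoly k[(M + M).+1]} :=
  (q + 1) *: (Kvar M i ^+ 2) - (q *: (Kvar M i * Kvar M (i - 1)) + Kvar M i * Kvar M (i + 1)).

(* p lies in the ideal generated by the relations with |i| < M and the
   u_i with -M <= i <= 0 (all generators living in the window). *)
Definition Kplus_ideal (q : k) (M : nat) (p : {mpoly k[(M + M).+1]}) : Prop :=
  exists c d : int -> {mpoly k[(M + M).+1]},
    p = \sum_(j < (M + M).+1)
          ((if (absz (j%:Z - M%:Z) < M)%N then c (j%:Z - M%:Z) * Krel q M (j%:Z - M%:Z) else 0)
         + (if j%:Z - M%:Z <= 0 then d (j%:Z - M%:Z) * Kvar M (j%:Z - M%:Z) else 0)).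

(* P = Q in K_+ (= k[u_i : i in Z]/(relations, u_i for i <= 0)):
   P - Q is in the ideal.  Any certificate involves finitely many
   variables/generators, hence lives in some window [-M, M]. *)
Definition Kplus_eq (q : k) (P Q : forall M : nat, {mpoly k[(M + M).+1]}) (N : nat) : Prop :=
  exists M : nat, (N <= M)%N /\ Kplus_ideal (M:=M) q (P M - Q M).

Definition usubst n (M : nat) : n.-tuple {mpoly k[(M + M).+1]} :=
  [tuple (if (j == 0 :> nat) then Kvar M 1 else Kvar M (j.+1)%:Z - Kvar M j%:Z) | j < n].

End Klyachko.

(* Main.v *)
Require Import Defs.
From HB Require Import structures.
From mathcomp Require Import all_boot all_order all_algebra all_fingroup.
From mathcomp Require Import mpoly.
From mathcomp Require Import ring_quotient ring zify.
From Stdlib Require Import ClassicalEpsilon.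
Import Order.TTheory GRing.Theory Num.Theory.
Local Open Scope ring_scope.

(** Let e_i generate the nilCoxeter algebra of S_n, h_i(x) = 1 + x e_i and
    A_i(x) = h_{n-1}(x) ... h_{i+1}(x) h_i(x).  After Fomin and Stanley, the
    coefficient of e_w in A_0(x_0) A_1(x_1) ... is the Schubert polynomial of w,
    and the A_i(x), A_i(y) commute, whence
    A_i(x) A_i(y)^-1 = A_{i+1}(x) h_i(x - y) A_{i+1}(y)^-1.

    Put u_m = x_0 + ... + x_{m-1}.  If (1 - s) u_m (x_m - s x_{m-1}) = 0 for all
    m, this exchange rule telescopes to
      prod_i A_i(x_i) = prod_i A_i(s x_i) . h_{n-1}((1-s) u_n) ... h_0((1-s) u_1).
    Since the coefficient of e_w is homogeneous of degree l(w), this is a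
    recursion on the length, but for s = q it is divisible by 1 - q and becomes
    void at q = 1.  So it is used over R[eps]/(eps^2 = (1-q) eps) with
    s = 1 - eps: the condition becomes the Klyachko relation multiplied by eps,
    1 - s^l = [l]_q eps, and comparing the eps-parts divides by 1 - q uniformly
    in q.  The weighted sums over reduced words satisfy the same recursion:
    multiplying by h_j changes the weight of exactly those words that end in j,
    from s^l to 1. *)

(** * Products in the nilCoxeter algebra *)

Section NilCoxeter.
Variables (R : comNzRingType) (d N : nat) (e : nat -> 'M[R]_d).
Hypotheses (e_sq : forall i, e i * e i = 0)
  (e_far : forall i j, (i.+1 < j)%N -> e i * e j = e j * e i)
  (e_braid : forall i, e i * e i.+1 * e i = e i.+1 * e i * e i.+1)
  (e_big : forall i, (N <= i)%N -> e i = 0).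

Definition hfac (i : nat) (x : R) : 'M[R]_d := 1 + x *: e i.

Fixpoint hdec (m i : nat) (x : R) : 'M[R]_d :=
  if m is m'.+1 then hdec m' i.+1 x * hfac i x else 1.

Fixpoint hdecV (m i : nat) (x : R) : 'M[R]_d :=
  if m is m'.+1 then hfac i (- x) * hdecV m' i.+1 x else 1.

Definition ser (i : nat) (x : R) : 'M[R]_d := hdec (N - i) i x.
(* The inverse of [ser i x]; it is not [ser i (- x)], the order being reversed. *)
Definition serV (i : nat) (x : R) : 'M[R]_d := hdecV (N - i) i x.

Lemma scale_mul (x y : R) (a b : 'M[R]_d) :
  (x *: a) * (y *: b) = (x * y) *: (a * b).
Proof. by rewrite -[LHS]scalemxAl -scalemxAr scalerA. Qed.

Lemma scaleAl (c : R) (a b : 'M[R]_d) : c *: (a * b) = (c *: a) * b.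
Proof. exact: scalemxAl. Qed.

Lemma scaleAr (c : R) (a b : 'M[R]_d) : c *: (a * b) = a * (c *: b).
Proof. exact: scalemxAr. Qed.

Lemma mul1D (x y : R) (a b : 'M[R]_d) :
  (1 + x *: a) * (1 + y *: b) = 1 + x *: a + y *: b + (x * y) *: (a * b).
Proof.
by rewrite mulrDl mul1r mulrDr mulr1 scale_mul !addrA -!addrA (addrCA (x *: a)).
Qed.

Lemma hfac0 i : hfac i 0 = 1.
Proof. by rewrite /hfac scale0r addr0. Qed.

Lemma hfacD i x y : hfac i x * hfac i y = hfac i (x + y).
Proof. by rewrite /hfac mul1D e_sq scaler0 addr0 scalerDl addrA. Qed.

Lemma hfacK i x : hfac i x * hfac i (- x) = 1.
Proof. by rewrite hfacD subrr hfac0. Qed.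

Lemma hfacVK i x : hfac i (- x) * hfac i x = 1.
Proof. by rewrite hfacD addNr hfac0. Qed.

Lemma hfac_big i x : (N <= i)%N -> hfac i x = 1.
Proof. by move=> /e_big; rewrite /hfac => ->; rewrite scaler0 addr0. Qed.

Lemma hfac_far i j x y : (i.+1 < j)%N -> GRing.comm (hfac i x) (hfac j y).
Proof.
move=> ij; rewrite /GRing.comm /hfac !mul1D e_far // (mulrC y x).
by rewrite (addrAC 1).
Qed.

(** Yang-Baxter equation with additive parameters: modulo the nilCoxeter relations both sides have
    the same coefficients on 1, the two generators, their two products and the braid word. *)
Lemma hfac_YB i x y :
  hfac i x * hfac i.+1 (x + y) * hfac i y
  = hfac i.+1 y * hfac i (x + y) * hfac i.+1 x.
Proof.
have braid := e_braid i; have sq := e_sq.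
rewrite /hfac !mul1D !mulrDl !mul1r !mulrDr !mulr1 !scale_mul !braid !sq.
move: (e i) (e i.+1) (e i * e i.+1) (e i.+1 * e i) (e i.+1 * e i * e i.+1) => D E A C B.
by apply/matrixP => s t; rewrite !mxE; ring.
Qed.

Lemma serS i x : ser i x = ser i.+1 x * hfac i x.
Proof.
rewrite /ser; case: (ltnP i N) => iN; first by rewrite subnS;
  case: (N - i)%N (subn_gt0 i N) => [|m]; rewrite ?iN.
have /eqP -> : (N - i == 0)%N by rewrite subn_eq0.
have /eqP -> : (N - i.+1 == 0)%N by rewrite subn_eq0 leqW.
by rewrite /= hfac_big ?mulr1.
Qed.

Lemma serVS i x : serV i x = hfac i (- x) * serV i.+1 x.
Proof.
rewrite /serV; case: (ltnP i N) => iN; first by rewrite subnS;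
  case: (N - i)%N (subn_gt0 i N) => [|m]; rewrite ?iN.
have /eqP -> : (N - i == 0)%N by rewrite subn_eq0.
have /eqP -> : (N - i.+1 == 0)%N by rewrite subn_eq0 leqW.
by rewrite /= hfac_big ?mulr1.
Qed.

Lemma ser_big i x : (N <= i)%N -> ser i x = 1.
Proof. by rewrite /ser -subn_eq0 => /eqP ->. Qed.

Lemma serV_big i x : (N <= i)%N -> serV i x = 1.
Proof. by rewrite /serV -subn_eq0 => /eqP ->. Qed.

Lemma down_ind (P : nat -> Prop) :
  (forall i, (N <= i)%N -> P i) -> (forall i, P i.+1 -> P i) -> forall i, P i.
Proof.
move=> Pbig PS i; have [m] := ubnP (N - i)%N.
elim: m i => [|m IHm] i //; case: (ltnP i N) => [iN|/Pbig //].
by move=> le_m; apply/PS/IHm; rewrite subnS; move: iN le_m;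
  rewrite -subn_gt0; case: (N - i)%N.
Qed.

Lemma serK i x : ser i x * serV i x = 1.
Proof.
elim/down_ind: i => [i iN|i IH]; first by rewrite ser_big ?serV_big ?mulr1.
by rewrite serS serVS -mulrA (mulrA (hfac i x)) hfacK mul1r.
Qed.

Lemma serVK i x : serV i x * ser i x = 1.
Proof.
elim/down_ind: i => [i iN|i IH]; first by rewrite ser_big ?serV_big ?mulr1.
by rewrite serS serVS -mulrA (mulrA (serV _ _)) IH mul1r hfacVK.
Qed.

Lemma hfac_ser_comm i j x y : (i.+1 < j)%N -> GRing.comm (hfac i x) (ser j y).
Proof.
elim/down_ind: j => [j jN|j IH] ij; first by rewrite ser_big //; apply: commr1.
rewrite serS; apply: commrM; last exact: hfac_far.
by apply: IH; rewrite ltnW.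
Qed.

(** Downward induction. Pulling A_{i+2}(y) to the left leaves h_i(x) h_{i+1}(y) h_i(y); splitting
    h_i(y) as h_i(y-x) h_i(x) allows Yang-Baxter. The resulting h_{i+1}(y) completes A_{i+1}(y),
    which passes A_{i+1}(x) by induction, and h_{i+1}(-x) cancels the last factor of the latter. *)
Lemma ser_comm i x y : GRing.comm (ser i x) (ser i y).
Proof.
elim/down_ind: i x y => [i iN|i IH] x y; first by rewrite !ser_big.
have far z t : hfac i z * ser i.+2 t = ser i.+2 t * hfac i z by apply: hfac_ser_comm.
have Si z : ser i.+2 z * hfac i.+1 z = ser i.+1 z by rewrite -serS.
have YB : hfac i x * hfac i.+1 y * hfac i (y - x)
          = hfac i.+1 (y - x) * hfac i y * hfac i.+1 x.
  by have := hfac_YB i x (y - x); rewrite (addrC x) subrK.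
have hy : hfac i y = hfac i (y - x) * hfac i x by rewrite hfacD subrK.
have L1 z t : ser i z * ser i t
    = ser i.+1 z * ser i.+2 t * (hfac i z * hfac i.+1 t * hfac i t).
  rewrite [ser i z]serS [ser i t]serS -(Si t) !mulrA.
  by rewrite -(mulrA _ (hfac i z)) far !mulrA.
have hy1 : hfac i.+1 (y - x) = hfac i.+1 y * hfac i.+1 (- x) by rewrite hfacD.
have E : hfac i x * hfac i.+1 y * hfac i y
    = hfac i.+1 y * hfac i.+1 (- x) * hfac i y * hfac i.+1 x * hfac i x.
  by rewrite {1}hy mulrA YB hy1.
rewrite /GRing.comm [LHS]L1 E L1 !mulrA -(mulrA _ (ser i.+2 y)) Si IH -(Si x).
by rewrite -!mulrA (mulrA (hfac i.+1 x) (hfac i.+1 (- x))) hfacK mul1r.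
Qed.

Lemma inv_comm (a b b' : 'M[R]_d) :
  b * b' = 1 -> b' * b = 1 -> GRing.comm a b -> GRing.comm a b'.
Proof.
rewrite /GRing.comm => bK b'K ab.
by rewrite -[LHS]mul1r -b'K -mulrA (mulrA b) -ab -!mulrA bK mulr1.
Qed.

Lemma ser_serV_comm i x y : GRing.comm (ser i x) (serV i y).
Proof. exact: inv_comm (serK i y) (serVK i y) (ser_comm i x y). Qed.

(** This is commutation of A_i(x) and A_i(y) with the final factor h_i(x) cancelled. It yields both
    the divided differences and the telescoping. *)
Lemma ser_exch i x y :
  ser i x * ser i.+1 y * hfac i (y - x) = ser i y * ser i.+1 x.
Proof.
have := ser_comm i x y; rewrite /GRing.comm [ser i y in LHS]serS mulrA.
rewrite [ser i x in RHS]serS mulrA => /(congr1 (fun z => z * hfac i (- x))).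
by rewrite -!mulrA hfacK mulr1 hfacD !mulrA.
Qed.

Lemma ser_ratio i x y :
  ser i x * serV i y = ser i.+1 x * hfac i (x - y) * serV i.+1 y.
Proof.
rewrite (ser_serV_comm i x y : _ = _).
have -> : ser i x = ser i y * ser i.+1 x * hfac i (x - y) * serV i.+1 y.
  by rewrite ser_exch -mulrA serK mulr1.
by rewrite !mulrA serVK mul1r.
Qed.

Lemma scale_ser i c y z : c * y = c * z -> c *: ser i y = c *: ser i z.
Proof.
move=> cyz; elim/down_ind: i => [i iN|i IH]; first by rewrite !ser_big.
rewrite (serS i y) (serS i z) !(scaleAl c (ser _ _)) IH -!scaleAl !scaleAr.
by rewrite /hfac !scalerDr !scalerA cyz.
Qed.

Lemma scale_serV i c y z : c * y = c * z -> c *: serV i y = c *: serV i z.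
Proof.
move=> cyz; elim/down_ind: i => [i iN|i IH]; first by rewrite !serV_big.
rewrite (serVS i y) (serVS i z) !(scaleAr c (hfac _ _)) IH -!scaleAr !scaleAl.
by rewrite /hfac !scalerDr !scalerA !mulrN cyz.
Qed.

(** Conjugation fixes 1 and affects only the term in e_j, which carries the factor c; so y matters
    only through c y. Since c may be a zero divisor, y = z cannot be assumed. *)
Lemma conj_hfac i j c y z : c * y = c * z ->
  ser i y * hfac j c * serV i y = ser i z * hfac j c * serV i z.
Proof.
move=> cyz.
have E t : ser i t * hfac j c * serV i t = 1 + (c *: ser i t) * e j * serV i t.
  by rewrite /hfac mulrDr mulr1 mulrDl serK -(scaleAr c) (scaleAl c).
rewrite !E (scale_ser i _ _ _ cyz) -!(scaleAl c) !(scaleAr c).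
by rewrite (scale_serV i _ _ _ cyz).
Qed.

Definition serprod (m : nat) (x : nat -> R) : 'M[R]_d :=
  \prod_(i < m) ser i (x i).

Lemma serprodS m x : serprod m.+1 x = serprod m x * ser m (x m).
Proof. by rewrite /serprod big_ord_recr. Qed.

(** [ser_exch] handles the factors i and i+1; all later factors have index at least i+2 and commute
    with h_i. *)
Lemma serprod_swap m i (x x' : nat -> R) :
  (i.+1 < m)%N -> x' i = x i.+1 -> x' i.+1 = x i ->
  (forall j, j != i -> j != i.+1 -> x' j = x j) ->
  serprod m x' = serprod m x * hfac i (x i.+1 - x i).
Proof.
move=> im x'i x'i1 x'x; elim: m im => // m IHm; rewrite ltnS leq_eqVlt.
case/predU1P=> [<-|im]; last first.
  rewrite !serprodS IHm // -!mulrA x'x ?gtn_eqF 1?(hfac_ser_comm i) //.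
  by rewrite ltnW.
rewrite !serprodS.
have -> : serprod i x' = serprod i x.
  apply: eq_bigr => j _; rewrite x'x //; first by rewrite ltn_eqF.
  by rewrite ltn_eqF // ltnS ltnW.
by rewrite x'i x'i1 -mulrA -ser_exch !mulrA.
Qed.

(** * Scaling the arguments by s *)

Section Scaling.
Variables (s : R) (x : nat -> R).
Let u (m : nat) : R := \sum_(i < m) x i.
Let c := 1 - s.
Hypothesis klyachko : forall m, (m < N)%N ->
  c * u m.+1 * x m.+1 = c * u m.+1 * (s * x m).

(* Unlike in [serprod], the index of all factors is the same [j]: this is what
   makes the induction on [m] in [Z_step] possible. *)
Let Z (j m : nat) := \prod_(i < m) (ser j (x i) * serV j (s * x i)).

Let ZS j m : Z j m.+1 = Z j m * (ser j (x m) * serV j (s * x m)).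
Proof. by rewrite /Z big_ord_recr. Qed.

(** By [ser_ratio] the new factor contributes h_j(c x_m), which merges with h_j(c u_m) into h_j(c
    u_{m+1}), conjugated by A_{j+1}(s x_m). The Klyachko condition and [conj_hfac] replace s x_m by
    x_{m+1}. *)
Let Z_step m j : (m <= N)%N ->
  Z j m = Z j.+1 m * (ser j.+1 (x m) * hfac j (c * u m) * serV j.+1 (x m)).
Proof.
elim: m => [|m IHm] mN.
  by rewrite /u big_ord0 mulr0 hfac0 mulr1 serK mulr1 /Z !big_ord0.
rewrite (conj_hfac _ _ _ _ _ (klyachko m mN)) !ZS IHm 1?ltnW // ser_ratio.
rewrite -!mulrA (mulrA (serV j.+1 (x m))) serVK mul1r (mulrA (hfac _ _)) hfacD.
rewrite (mulrA (serV j.+1 (s * _))) serVK mul1r.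
by rewrite /u big_ord_recr /= mulrDr (mulrBl (x m)) mul1r.
Qed.

Fixpoint hprod (m : nat) : 'M[R]_d :=
  if m is m'.+1 then hfac m' (c * u m) * hprod m' else 1.

Let hprod_ser_comm m j y : (m <= j)%N -> GRing.comm (hprod m) (ser j.+1 y).
Proof.
elim: m => [|m IHm] mj; first exact/commr_sym/commr1.
apply/commr_sym/commrM; last by apply/commr_sym/IHm/ltnW.
exact/commr_sym/hfac_ser_comm.
Qed.

Lemma serprod_scale : serprod N x = serprod N (fun i => s * x i) * hprod N.
Proof.
(* Invariant: the first k arguments are already scaled and [Z k k] collects the ratios. In the step
   A_k(s x_k) is split off A_k(x_k) and moved left through Z; [Z_step] then raises the index and
   emits h_k, its trailing inverse cancelling the next factor A_{k+1}(x_{k+1}). *)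
have key k : (k <= N)%N -> serprod k.+1 x =
    serprod k (fun i => s * x i) * (Z k k * ser k (x k)) * hprod k.
  elim: k => [|k IHk] kN.
    by rewrite serprodS /serprod /Z !big_ord0 /= !mul1r mulr1.
  rewrite serprodS IHk 1?ltnW // -mulrA hprod_ser_comm // !mulrA.
  have -> : serprod k (fun i => s * x i) * Z k k * ser k (x k)
      = serprod k.+1 (fun i => s * x i) * Z k k.+1.
    have Zcomm m : GRing.comm (ser k (s * x k)) (Z k m).
      by apply: commr_prod => i _; apply: commrM; [apply: ser_comm | apply: ser_serV_comm].
    by rewrite serprodS -(mulrA _ (ser _ _)) Zcomm ZS -!mulrA serVK mulr1.
  rewrite (Z_step _ _ kN) /= -!mulrA (mulrA (serV _ _)) serVK mul1r.
  by rewrite !mulrA.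
have := key N (leqnn N); rewrite serprodS ser_big // mulr1 => ->.
rewrite (_ : Z N N = 1) ?mulr1 //.
by apply: big1 => i _; rewrite ser_big ?serV_big ?mulr1.
Qed.

End Scaling.

End NilCoxeter.

(** * The nilCoxeter algebra of S_n *)

Section SimpleReflections.
Variable n : nat.
Implicit Types (w v : 'S_n) (i j : 'I_n).

Lemma nextposE i : (i.+1 < n)%N -> nextpos i = i.+1 :> nat.
Proof. by move=> lt_i; rewrite /nextpos insubdK. Qed.

Lemma srefK i w : (sref i * (sref i * w) = w)%g.
Proof. by rewrite mulgA tperm2 mul1g. Qed.

Lemma sref_id i j : (j : nat) != i -> (j : nat) != i.+1 -> sref i j = j.
Proof.
move=> ji ji1; rewrite /sref; case: (ltnP i.+1 n) => lt_i.
  by rewrite tpermD // -val_eqE /= eq_sym // nextposE.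
(* At the last position [nextpos] defaults to i itself, so [sref i] is the identity. *)
rewrite (_ : nextpos i = i) ?tperm1 ?perm1 //.
by rewrite /nextpos /insubd insubF // ltnNge lt_i.
Qed.

Lemma srefL i : sref i i = nextpos i. Proof. exact: tpermL. Qed.
Lemma srefR i : sref i (nextpos i) = i. Proof. exact: tpermR. Qed.

(** Exchanging positions i and i+1 in both components is an involution on pairs of positions; it
    matches the inversions of the two permutations apart from the pair (i, i+1). *)
Lemma perm_length_desc w i : (i.+1 < n)%N -> (w (nextpos i) < w i)%N ->
  perm_length w = (perm_length (sref i * w)%g).+1.
Proof.
move=> lt_i wi; have ni := nextposE i lt_i.
rewrite /perm_length (cardsD1 (i, nextpos i)) inE /= ni ltnSn wi.
congr _.+1; pose phi (p : 'I_n * 'I_n) := (sref i p.1, sref i p.2).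
have phiK : involutive phi by move=> [a b]; rewrite /phi /= !tpermK.
rewrite -(card_preimset _ (inv_inj phiK)); apply: eq_card => -[a b].
rewrite !inE /= xpair_eqE !permM.
have neq (x y : 'I_n) : x <> y -> (x : nat) <> y by move=> xy /val_inj.
rewrite -!val_eqE /= /sref; set i' := nextpos i in wi ni *.
case: (tpermP i i' a) => [->|->|/neq ai /neq ai'];
  case: (tpermP i i' b) => [->|->|/neq bi /neq bi']; rewrite ?eqxx ?ni; try lia.
Qed.

Lemma perm_length_asc w i : (i.+1 < n)%N -> (w i < w (nextpos i))%N ->
  perm_length (sref i * w)%g = (perm_length w).+1.
Proof.
move=> lt_i wi; rewrite (perm_length_desc _ i) // ?srefK //.
by rewrite !permM srefL srefR.
Qed.

(** Letters are extended to all naturals to fit the family e_i above; outside the range there is no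
    descent, so e_i becomes 0. *)
Definition nsref (i : nat) : 'S_n := if (insub i : option 'I_n) is Some i' then sref i' else 1%g.

Definition descent w (i : nat) : bool :=
  if (insub i : option 'I_n) is Some i' then (i'.+1 < n)%N && (w (nextpos i') < w i')%N
  else false.

Lemma nsref_ord i : nsref i = sref i.
Proof. by rewrite /nsref valK. Qed.

Lemma descent_ord w i :
  descent w i = (i.+1 < n)%N && (w (nextpos i) < w i)%N.
Proof. by rewrite /descent valK. Qed.

Lemma descent_lt w (i : nat) : descent w i -> (i.+1 < n)%N.
Proof. by rewrite /descent; case: insubP => // i' _ <- /andP[]. Qed.

Lemma descent_length w (i : nat) : descent w i ->
  perm_length w = (perm_length (nsref i * w)%g).+1.
Proof.
move=> dw; have /ltnW lt_i := descent_lt _ _ dw; move: dw.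
rewrite -[i]/(val (Ordinal lt_i)) descent_ord nsref_ord => /andP[? ?].
exact: perm_length_desc.
Qed.

Lemma descent_nsref w (i : nat) : descent w i -> ~~ descent (nsref i * w)%g i.
Proof.
move=> dw; have /ltnW lt_i := descent_lt _ _ dw; move: dw.
rewrite -[i]/(val (Ordinal lt_i)) !descent_ord nsref_ord => /andP[-> wi].
by rewrite !permM srefL srefR -leqNgt ltnW.
Qed.

Lemma nsrefK (i : nat) w : (nsref i * (nsref i * w) = w)%g.
Proof. by rewrite /nsref; case: insub => [i'|]; rewrite ?srefK ?mul1g. Qed.

Lemma descent_far w (i j : nat) : (i.+1 < j)%N || (j.+1 < i)%N ->
  descent (nsref i * w)%g j = descent w j.
Proof.
move=> ij; rewrite {1 2}/descent; case: insubP => // j' _ def_j.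
case lt_j: (j'.+1 < n)%N => //=; rewrite /nsref; case: insubP => [i' _ def_i|]; last by rewrite mul1g.
by move: def_i def_j => /= def_i def_j; rewrite !permM !sref_id ?nextposE //; lia.
Qed.

Lemma sref_far i j : (i.+1 < j)%N -> (sref i * sref j = sref j * sref i)%g.
Proof.
move=> ij; case: (ltnP j.+1 n) => lt_j; last first.
  by rewrite [sref j]/sref /nextpos /insubd insubF ?tperm1 ?mulg1 ?mul1g // ltnNge lt_j.
by rewrite [LHS]conjgC [sref j]/sref tpermJ !sref_id ?nextposE //; lia.
Qed.

Lemma nsref_far w (i j : nat) : (i.+1 < j)%N -> (j < n)%N ->
  (nsref i * (nsref j * w) = nsref j * (nsref i * w))%g.
Proof.
move=> ij lt_j; have lt_i : (i < n)%N by lia.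
rewrite -[i]/(val (Ordinal lt_i)) -[j]/(val (Ordinal lt_j)) !nsref_ord.
by rewrite !mulgA sref_far.
Qed.

(** Both chains of descents test the same three comparisons, namely that w decreases on i, i+1, i+2,
    in opposite orders. *)
Lemma braid_perm w (i j : 'I_n) : j = i.+1 :> nat -> (j.+1 < n)%N ->
 [/\ descent w i && descent (sref i * w)%g j && descent (sref j * (sref i * w))%g i =
   descent w j && descent (sref j * w)%g i && descent (sref i * (sref j * w))%g j &
  (sref i * (sref j * (sref i * w)) = sref j * (sref i * (sref j * w)))%g].
Proof.
move=> ji ltj; have lti : (i.+1 < n)%N by rewrite -ji.
have nij : nextpos i = j by apply: val_inj; rewrite /= nextposE.
have := nextposE j ltj; set m := nextpos j => mj.
have sii : sref i i = j by rewrite srefL.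
have sij : sref i j = i by rewrite -nij srefR.
have sim : sref i m = m by rewrite sref_id // mj; lia.
have sjj : sref j j = m by rewrite srefL.
have sjm : sref j m = j by rewrite srefR.
have sji : sref j i = i by rewrite sref_id // ; lia.
split.
  rewrite !descent_ord lti ltj nij -/m !permM !(sii, sij, sim, sjj, sjm, sji) /=.
  by do 3! case: (_ < _)%N.
rewrite !mulgA; congr (_ * _)%g; apply/permP => x; rewrite !permM.
case: (x =P i) => [->|/eqP xi]; first by rewrite !(sii, sij, sim, sjj, sjm, sji).
case: (x =P j) => [->|/eqP xj]; first by rewrite !(sii, sij, sim, sjj, sjm, sji).
case: (x =P m) => [->|/eqP xm]; first by rewrite !(sii, sij, sim, sjj, sjm, sji).
have six : sref i x = x by rewrite sref_id // -ji.
have sjx : sref j x = x by rewrite sref_id // -mj.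
by rewrite !(six, sjx).
Qed.

End SimpleReflections.

(** * The regular representation and its coefficients *)

Section Operators.
Variables (n : nat) (R : comNzRingType).
Local Notation d := #|{: 'S_n}|.

(* Row vectors are functions on S_n, i.e. elements of the nilCoxeter algebra;
   [Tmx i] is right multiplication by e_i. *)
Definition Tmx (i : nat) : 'M[R]_d := \matrix_(a, b)
  (descent n (enum_val b) i && (enum_val a == nsref n i * enum_val b)%g)%:R.

Definition coef (f : 'rV[R]_d) (w : 'S_n) : R := f 0 (enum_rank w).

Lemma coefP (f g : 'rV[R]_d) : (forall w, coef f w = coef g w) -> f = g.
Proof.
by move=> fg; apply/rowP => a; have := fg (enum_val a); rewrite /coef enum_valK.
Qed.

Lemma coef_T f i w :
  coef (f *m Tmx i) w = if descent n w i then coef f (nsref n i * w)%g else 0.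
Proof.
rewrite /coef mxE (bigD1 (enum_rank (nsref n i * w)%g)) //= !mxE !enum_rankK eqxx.
rewrite andbT big1 ?addr0 => [|a /negPf na]; first by case: descent; rewrite ?mulr1 ?mulr0.
rewrite mxE enum_rankK (_ : _ == _ = false) ?andbF ?mulr0 //.
by apply/negbTE; apply: contraFneq na => <-; rewrite enum_valK.
Qed.

Lemma row_mulP (A B : 'M[R]_d) : (forall f : 'rV_d, f *m A = f *m B) -> A = B.
Proof. by move=> AB; apply/row_matrixP => a; rewrite !rowE. Qed.

Lemma row_mulA (f : 'rV[R]_d) (A B : 'M_d) : f *m (A * B) = f *m A *m B.
Proof. exact: mulmxA. Qed.

Lemma T_sq i : Tmx i * Tmx i = 0.
Proof.
apply: row_mulP => f; apply: coefP => w; rewrite row_mulA !coef_T mulmx0.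
case: ifP => [/descent_nsref/negPf -> |_]; by rewrite /coef mxE.
Qed.

Lemma T_far i j : (i.+1 < j)%N -> Tmx i * Tmx j = Tmx j * Tmx i.
Proof.
move=> ij; apply: row_mulP => f; apply: coefP => w; rewrite !row_mulA !coef_T.
rewrite !descent_far ?ij ?orbT //.
case: (boolP (descent n w j)) => [dj|_]; last by case: ifP.
by case: ifP => // di; rewrite nsref_far //; have := descent_lt _ _ _ dj; lia.
Qed.

Lemma T_big i : (n <= i)%N -> Tmx i = 0.
Proof.
move=> ni; apply/matrixP => a b; rewrite !mxE /descent insubF //.
by rewrite ltnNge ni.
Qed.

Lemma T_braid i : Tmx i * Tmx i.+1 * Tmx i = Tmx i.+1 * Tmx i * Tmx i.+1.
Proof.
apply: row_mulP => f; apply: coefP => w; rewrite !row_mulA !coef_T.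
case: (ltnP i.+2 n) => [lt_i|le_i]; last first.
  have dF v : descent n v i.+1 = false.
    by apply/negP => /descent_lt; rewrite ltnNge le_i.
  by rewrite !dF; case: ifP.
have lt_j := ltnW lt_i; have lt_k := ltnW lt_j.
have := braid_perm n w (Ordinal lt_k) (Ordinal lt_j) (erefl _) lt_i.
rewrite -!nsref_ord /= => -[E1 E2]; rewrite E2 -!if_and. by rewrite E1.

Qed.

Definition delta1 : 'rV[R]_d := \row_a (enum_val a == 1%g)%:R.

Lemma coef_delta1 w : coef delta1 w = (w == 1%g)%:R.
Proof. by rewrite /coef mxE enum_rankK. Qed.

Lemma perm_length1 : perm_length (1%g : 'S_n) = 0%N.
Proof.
apply/eqP; rewrite cards_eq0; apply/eqP/setP => p.
by rewrite !inE !perm1; case: ltngtP.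
Qed.

Lemma coef_hfac f i x w : coef (f *m hfac R d Tmx i x) w =
  coef f w + x * (if descent n w i then coef f (nsref n i * w)%g else 0).
Proof.
rewrite -coef_T /hfac mulmxDr mulmx1 -scalemxAr.
by rewrite {1}/coef mxE [X in _ + X]mxE.
Qed.

(* Conjugation by [lenmx s] rescales every e_i by s, which encodes homogeneity. *)
Definition lenmx (s : R) : 'M[R]_d :=
  diag_mx (\row_a s ^+ perm_length (enum_val a)).

Lemma coef_lenmx f s w : coef (f *m lenmx s) w = coef f w * s ^+ perm_length w.
Proof.
rewrite /coef /lenmx mul_mx_diag !mxE enum_rankK //.
Qed.

Lemma hfac_lenmx i x s :
  hfac R d Tmx i x * lenmx s = lenmx s * hfac R d Tmx i (s * x).
Proof.
apply: row_mulP => f; apply: coefP => w; rewrite !row_mulA.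
rewrite coef_lenmx !coef_hfac !coef_lenmx mulrDl; congr (_ + _).
case: (boolP (descent n w i)) => [/descent_length -> |_]; last by rewrite !mulr0 mul0r.
by rewrite exprS; ring.
Qed.

Lemma ser_lenmx i x s :
  ser R d n Tmx i x * lenmx s = lenmx s * ser R d n Tmx i (s * x).
Proof.
elim/(down_ind n): i => [i ni|i IH]; first by rewrite !ser_big // mulr1 mul1r.
rewrite (serS _ _ _ _ T_big i x) (serS _ _ _ _ T_big i (s * x)).
by rewrite -mulrA hfac_lenmx !mulrA IH.
Qed.

Lemma serprod_lenmx m (x : nat -> R) s :
  serprod R d n Tmx m x * lenmx s
  = lenmx s * serprod R d n Tmx m (fun i => s * x i).
Proof.
elim: m => [|m IHm]; first by rewrite /serprod !big_ord0 mulr1 mul1r.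
by rewrite !serprodS -mulrA ser_lenmx !mulrA IHm.
Qed.

(** The Fomin-Stanley form of the Schubert polynomial of w, evaluated at x. An arbitrary ring is
    allowed, so that it makes sense over polynomials, in the quotient and over the eps-ring. *)
Definition schubval (x : nat -> R) (w : 'S_n) : R :=
  coef (delta1 *m serprod R d n Tmx n x) w.

(** Homogeneity: [lenmx s] passes through the product, scaling every argument, and fixes [delta1]
    because the identity has length 0. *)
Lemma schubval_scale s x w :
  schubval (fun i => s * x i) w = s ^+ perm_length w * schubval x w.
Proof.
rewrite mulrC /schubval -coef_lenmx -row_mulA serprod_lenmx row_mulA.
congr (coef (_ *m _) w); apply: coefP => v; rewrite coef_lenmx coef_delta1.
by case: eqP => [->|_]; rewrite ?mul0r // perm_length1 mulr1.
Qed.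

(** The divided difference recursion in division-free form, read off [serprod_swap] at e_w. *)
Lemma schubval_swap i (x x' : nat -> R) w :
  (i.+1 < n)%N -> x' i = x i.+1 -> x' i.+1 = x i ->
  (forall j, j != i -> j != i.+1 -> x' j = x j) ->
  schubval x w - schubval x' w = (x i - x i.+1) *
    (if descent n w i then schubval x (nsref n i * w)%g else 0).
Proof.
move=> lt_i x'i x'i1 x'x; rewrite /schubval.
rewrite (serprod_swap R d n Tmx T_sq T_far T_braid T_big _ _ _ _ lt_i x'i x'i1 x'x).
by rewrite row_mulA coef_hfac opprD addrA subrr sub0r -mulNr opprB.
Qed.

Lemma schubval_fixpoint (s : R) (x : nat -> R) w :
  (forall m, (m < n)%N -> (1 - s) * (\sum_(i < m.+1) x i) * x m.+1
      = (1 - s) * (\sum_(i < m.+1) x i) * (s * x m)) ->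
  schubval x w = coef (delta1 *m serprod R d n Tmx n (fun i => s * x i)
      *m hprod R d Tmx s x n) w.
Proof.
move=> hx; rewrite /schubval -row_mulA; congr (coef (_ *m _) w).
exact: (serprod_scale R d n Tmx T_sq T_far T_braid T_big).
Qed.

End Operators.

(** * Compatibility with ring morphisms *)

Section Morphism.
Variables (n : nat) (R S : comNzRingType) (phi : {rmorphism R -> S}).
Local Notation d := #|{: 'S_n}|.

Lemma map_Tmx i : map_mx phi (Tmx n R i) = Tmx n S i.
Proof. by apply/matrixP => a b; rewrite !mxE rmorph_nat. Qed.

Lemma map_hfac i x :
  map_mx phi (hfac R d (Tmx n R) i x) = hfac S d (Tmx n S) i (phi x).
Proof. by rewrite /hfac map_mxD map_mx1 map_mxZ map_Tmx. Qed.

Lemma map_ser i x :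
  map_mx phi (ser R d n (Tmx n R) i x) = ser S d n (Tmx n S) i (phi x).
Proof.
elim/(down_ind n): i => [i ni|i IH]; first by rewrite !ser_big // map_mx1.
rewrite (serS _ _ _ _ (T_big n R) i x) (serS _ _ _ _ (T_big n S) i (phi x)).
by rewrite [LHS]map_mxM IH map_hfac.
Qed.

Lemma map_serprod m x :
  map_mx phi (serprod R d n (Tmx n R) m x)
  = serprod S d n (Tmx n S) m (fun i => phi (x i)).
Proof.
elim: m => [|m IHm]; first by rewrite /serprod !big_ord0 map_mx1.
by rewrite !serprodS [LHS]map_mxM map_ser IHm.
Qed.

Lemma map_schubval x w : phi (schubval n R x w) = schubval n S (fun i => phi (x i)) w.
Proof.
rewrite /schubval /coef -map_serprod.
have -> : delta1 n S = map_mx phi (delta1 n R).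
  by apply/matrixP => a b; rewrite !mxE rmorph_nat.
by rewrite -map_mxM [RHS]mxE.
Qed.

End Morphism.

(** * Identification with Schubert polynomials *)

Section Staircase.
Variables (n : nat) (R : comNzRingType).
Local Notation d := #|{: 'S_n}|.
Local Notation T := (Tmx n R).

Definition leading (f : 'rV[R]_d) (sigma : 'S_n) (c : R) : Prop :=
  (forall w, (perm_length sigma < perm_length w)%N -> coef n R f w = 0) /\
  (forall w, perm_length w = perm_length sigma ->
     coef n R f w = if w == sigma then c else 0).

(** Only the summand x f e_i reaches the new top length, and there it comes from the top of f alone;
    distinct basis elements not killed by e_i have distinct images. *)
Lemma leading_hfac f sigma c i x : (i.+1 < n)%N -> ~~ descent n sigma i ->
  leading f sigma c ->
  leading (f *m hfac R d T i x) (nsref n i * sigma)%g (c * x).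
Proof.
move=> lt_i asc [f0 ftop].
have dsc : descent n (nsref n i * sigma)%g i.
  have lt_i' := ltnW lt_i; move: asc; rewrite -[i]/(val (Ordinal lt_i')).
  rewrite !descent_ord nsref_ord !permM srefL srefR /= lt_i /= -leqNgt leq_eqVlt.
  case/predU1P => // /val_inj/perm_inj/(congr1 val) /=.
  by rewrite nextposE //= => E; lia.
have lenS : perm_length (nsref n i * sigma)%g = (perm_length sigma).+1.
  by rewrite (descent_length _ _ _ dsc) nsrefK.
split=> w; rewrite lenS coef_hfac => lw.
  rewrite f0 ?(ltnW lw) // add0r; case: ifP => [dw|_]; last by rewrite mulr0.
  by rewrite f0 ?mulr0 //; move: lw; rewrite (descent_length _ _ _ dw).
rewrite f0 ?lw // add0r; case: ifP => [dw|ndw]; last first.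
  by rewrite mulr0; case: eqP => // E; rewrite E dsc in ndw.
rewrite ftop; last by apply/eq_add_S; rewrite -lw (descent_length _ _ _ dw).
rewrite -(inj_eq (mulgI (nsref n i))) nsrefK.
by case: eqP => _; rewrite ?mulr0 // mulrC.
Qed.

(* One-line notation of the product of the first [m] decreasing runs
   s_{n-2} ... s_0, s_{n-2} ... s_1, ... and of the part of the next run that
   goes down to the letter [k]. *)
Definition stair (m k p : nat) : nat :=
  if (p < m)%N then (n.-1 - p)%N else
  if (p < k)%N then (p - m)%N else
  if p == k then (n.-1 - m)%N else (p.-1 - m)%N.

Definition is_stair (m k : nat) (sigma : 'S_n) : Prop :=
  forall p : 'I_n, sigma p = stair m k p :> nat.

(** A run carries the largest value not yet placed, n-1-m, from the last position leftwards. Each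
    letter of it acts at an ascent, hence contributes one factor x. *)
Lemma stair_ser f sigma c m k x : (m <= k)%N -> (k < n)%N ->
  is_stair m n.-1 sigma -> leading f sigma c ->
  exists2 sigma', is_stair m k sigma' &
    leading (f *m ser R d n T k x) sigma' (c * x ^+ (n.-1 - k)).
Proof.
move=> mk kn st_s lead_f.
(* The run is still empty here: e_{n-1} = 0, since there is no descent at the last position. *)
have base : exists2 s', is_stair m n.-1 s' &
    leading (f *m ser R d n T n.-1 x) s' (c * x ^+ (n.-1 - n.-1)).
  exists sigma => //; rewrite subnn expr0 mulr1.
  rewrite (serS _ _ _ _ (T_big n R)) ser_big; last by lia.
  rewrite mul1r /hfac (_ : T n.-1 = 0) ?scaler0 ?addr0 ?mulmx1 //.
  apply/matrixP => a b; rewrite !mxE.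
  by case: (boolP (descent _ _ _)) => // /descent_lt; lia.
have last j : (n.-1 <= j)%N -> (j < n)%N -> j = n.-1 by lia.
elim/(down_ind n.-1): k mk kn => [k le_k|k IH] mk kn; first by rewrite (last k).
case: (leqP n.-1 k) => lt_k; first by rewrite (last k).
have [||s' st_s' lead'] := IH; [lia|lia|].
exists (nsref n k * s')%g.
  have Ek : k = val (Ordinal kn) by [].
  move=> p; rewrite {1}Ek nsref_ord permM /sref.
  have nk : nextpos (Ordinal kn) = k.+1 :> nat by rewrite nextposE //=; lia.
  have neq (y z : 'I_n) : y <> z -> (y : nat) <> z by move=> yz /val_inj.
  case: (tpermP (Ordinal kn) (nextpos (Ordinal kn)) p) => [->|->|/neq /= pk /neq pk'];
    by rewrite st_s' /stair ?nk /=; repeat case: ifP; lia.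
rewrite (serS _ _ _ _ (T_big n R)) row_mulA.
have -> : (n.-1 - k = (n.-1 - k.+1).+1)%N by lia.
rewrite exprSr mulrA; apply: leading_hfac => //; first by lia.
rewrite -[k]/(val (Ordinal kn)) descent_ord negb_and -leqNgt !st_s' nextposE /=; last by lia.
apply/orP; right; rewrite /stair; repeat case: ifP; lia.
Qed.

Lemma leading_serprod m (x : nat -> R) : (m <= n)%N ->
  exists2 sigma, is_stair m n.-1 sigma &
   leading (delta1 n R *m serprod R d n T m x) sigma (\prod_(i < m) x i ^+ (n.-1 - i)).
Proof.
elim: m => [|m IHm] mn.
  exists 1%g; first by move=> p; rewrite perm1 /stair; have := ltn_ord p; repeat case: ifP; lia.
  rewrite /serprod !big_ord0 mulmx1; split => w; rewrite coef_delta1.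
    by case: eqP => // ->; rewrite ltnn.
  by move=> _; case: eqP.
have [s st_s lead] := IHm (ltnW mn).
have [s' st_s' lead'] := stair_ser _ _ _ _ m (x m) (leqnn m) mn st_s lead.
exists s'; last by rewrite serprodS row_mulA big_ord_recr.
(* Run m completed down to the letter m is the same permutation as run m+1 not yet begun. *)
move=> p; rewrite st_s' /stair; have := ltn_ord p; repeat case: ifP; lia.
Qed.

Lemma w0E (i : 'I_n) : w0 n i = (n.-1 - i)%N :> nat.
Proof. by rewrite permE /=; lia. Qed.

Lemma schubval_w0 (x : nat -> R) :
  schubval n R x (w0 n) = \prod_(i < n) x i ^+ (n.-1 - i).
Proof.
have [s st_s [_ top]] := leading_serprod n x (leqnn n).
have -> : w0 n = s.
  by apply/permP => i; apply: val_inj; rewrite /= st_s w0E /stair ltn_ord.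
by rewrite /schubval top // eqxx.
Qed.

End Staircase.

(** * Characterisations of the longest element *)

Section LongestElement.
Variable n : nat.

Lemma perm_length_w0 (w : 'S_n) : (perm_length w <= perm_length (w0 n))%N.
Proof.
apply: subset_leq_card; apply/subsetP => -[a b]; rewrite !inE /= => /andP[lt_p _].
rewrite lt_p !w0E; have := ltn_ord b; lia.
Qed.

Lemma no_ascent_w0 (w : 'S_n) :
  (forall i : 'I_n, (i.+1 < n)%N -> ~~ (w i < w (nextpos i))%N) -> w = w0 n.
Proof.
move=> noasc.
have dec (i j : 'I_n) : j = i.+1 :> nat -> (w j < w i)%N.
  move=> ji; have lt_i : (i.+1 < n)%N by rewrite -ji.
  have -> : j = nextpos i by apply: val_inj; rewrite /= nextposE.
  have := noasc i lt_i; rewrite -leqNgt leq_eqVlt => /predU1P[/val_inj/perm_inj/(congr1 val)|//].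
  by rewrite /= nextposE //; lia.
have up m (i : 'I_n) : i = m :> nat -> (w i + i <= n.-1)%N.
  elim: m i => [|m IHm] i im; first by have := ltn_ord (w i); lia.
  have lt_m : (m < n)%N by have := ltn_ord i; lia.
  have := IHm (Ordinal lt_m) (erefl _); have := dec (Ordinal lt_m) i im.
  by rewrite /=; lia.
have down m (i : 'I_n) : (i + m = n.-1)%N -> (m <= w i)%N.
  elim: m i => [|m IHm] i im //.
  have lt_i : (i.+1 < n)%N by lia.
  apply: leq_ltn_trans (dec i (Ordinal lt_i) (erefl _)).
  by apply: IHm; rewrite /=; lia.
apply/permP => i; apply: val_inj; rewrite /= w0E.
by have := up i i (erefl _); have := down (n.-1 - i)%N i; have := ltn_ord i; lia.
Qed.

End LongestElement.

(** * Divided differences and the recursion for Schubert polynomials *)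

Section Schubert.
Variables (k : fieldType) (n : nat).

Definition xvar (i : nat) : {mpoly k[n]} :=
  if (insub i : option 'I_n) is Some i' then 'X_i' else 0.

Lemma xvar_ord (i : 'I_n) : xvar i = 'X_i.
Proof. by rewrite /xvar valK. Qed.

Lemma xvar_swap (i : 'I_n) : (i.+1 < n)%N ->
  let t := [tuple 'X_(sref i j) | j < n] : n.-tuple {mpoly k[n]} in
  [/\ xvar i \mPo t = xvar i.+1, xvar i.+1 \mPo t = xvar i &
   forall j : nat, j != i -> j != i.+1 -> xvar j \mPo t = xvar j].
Proof.
move=> lt_i t; have tE (j : 'I_n) : xvar j \mPo t = xvar (sref i j).
  by rewrite !xvar_ord comp_mpolyXU -tnth_nth tnth_mktuple.
rewrite -nextposE // !tE srefL srefR; split=> // j ji ji1.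
rewrite nextposE // in ji1.
rewrite /xvar; case: insubP => [j' _ def_j|_]; last exact: comp_mpoly0.
by rewrite -(xvar_ord j') tE sref_id ?xvar_ord // def_j.
Qed.

Lemma swapvars_schubval (i : 'I_n) w : (i.+1 < n)%N ->
  schubval n _ xvar w - swapvars i (schubval n _ xvar w) =
  ('X_i - 'X_(nextpos i)) *
    (if descent n w i then schubval n _ xvar (sref i * w)%g else 0).
Proof.
move=> lt_i; have [xi xi1 xj] := xvar_swap i lt_i.
rewrite /swapvars (map_schubval _ _ _ (comp_mpoly _)).
rewrite (schubval_swap _ _ i xvar) // nsref_ord xvar_ord.
by rewrite -nextposE // xvar_ord.
Qed.

Lemma X_neq (i j : 'I_n) : i != j -> 'X_i - 'X_j != 0 :> {mpoly k[n]}.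
Proof.
move=> ij; rewrite subr_eq0; apply/eqP => /(congr1 (meval (fun l => (l == i)%:R))).
by move/eqP; rewrite !mevalXU eqxx (eq_sym j) (negPf ij) oner_eq0.
Qed.

(** [swapvars_schubval] provides a quotient, so the chosen one satisfies its specification;
    cancelling the nonzero difference of variables identifies the two. *)
Lemma divdiff_schubval (i : 'I_n) w : (i.+1 < n)%N -> descent n w i ->
  divdiff i (schubval n _ xvar w) = schubval n _ xvar (sref i * w)%g.
Proof.
move=> lt_i dw; have E := swapvars_schubval i w lt_i; rewrite dw in E.
rewrite /divdiff; set P := fun h => _.
have Pe : P (epsilon (inhabits 0) P).
  by apply: epsilon_spec; exists (schubval n _ xvar (sref i * w)%g); rewrite /P E.
have neq : i != nextpos i by rewrite -val_eqE /= nextposE // ltn_eqF.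
by apply: (mulfI (X_neq _ _ neq)); rewrite -E.
Qed.

(** Whichever ascent [pick] selects, [schubval] obeys the recursion there. When the fuel is
    exhausted w has maximal length, so it has no ascent and is the longest element. *)
Lemma schub_aux_schubval m (w : 'S_n) :
  (perm_length (w0 n) - perm_length w = m)%N -> schub_aux k m w = schubval n _ xvar w.
Proof.
have w0P : schub_w0 k n = schubval n _ xvar (w0 n).
  by rewrite schubval_w0; apply: eq_bigr => i _; rewrite xvar_ord.
elim: m w => [|m IHm] w len_w /=.
  rewrite w0P (_ : w = w0 n) //; apply: no_ascent_w0 => i lt_i; apply/negP => asc.
  by have := perm_length_w0 n (sref i * w)%g; rewrite perm_length_asc //; lia.
case: pickP => [i /andP[lt_i asc]|noasc]; last first.
  rewrite w0P -(no_ascent_w0 n w) // => i lt_i.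
  by have := noasc i; rewrite lt_i /= => ->.
have lenS := perm_length_asc n w i lt_i asc.
rewrite IHm; last by rewrite lenS; lia.
rewrite divdiff_schubval ?srefK //.
by rewrite descent_ord lt_i !permM srefL srefR.
Qed.

Lemma schubert_schubval w : schubert k w = schubval n _ xvar w.
Proof. exact: schub_aux_schubval. Qed.

End Schubert.

(** * The weighted sums over reduced words *)

(* The pair (a, b) stands for a + b eps, where eps^2 = t eps. *)
Definition epsring (R : comNzRingType) (t : R) : Type := (R * R)%type.

Section EpsRing.
Variables (R : comNzRingType) (t : R).
Local Notation S := (epsring R t).

HB.instance Definition _ := GRing.Zmodule.copy S (R * R)%type.

Definition eps_one : S := (1, 0).
Definition eps_mul (a b : S) : S :=
  (a.1 * b.1, a.1 * b.2 + a.2 * b.1 + t * (a.2 * b.2)).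

Lemma eps_mulA : associative eps_mul.
Proof. by move=> [a1 a2] [b1 b2] [c1 c2]; congr pair; rewrite /=; ring. Qed.
Lemma eps_mulC : commutative eps_mul.
Proof. by move=> [a1 a2] [b1 b2]; congr pair; rewrite /=; ring. Qed.
Lemma eps_mul1 : left_id eps_one eps_mul.
Proof. by move=> [a1 a2]; congr pair; rewrite /=; ring. Qed.
Lemma eps_mulD : left_distributive eps_mul +%R.
Proof. by move=> [a1 a2] [b1 b2] [c1 c2]; congr pair; rewrite /=; ring. Qed.
Lemma eps_oner : eps_one != 0.
Proof. by apply/eqP => /(congr1 fst)/eqP; rewrite /= oner_eq0. Qed.

HB.instance Definition _ :=
  GRing.Zmodule_isComNzRing.Build S eps_mulA eps_mulC eps_mul1 eps_mulD eps_oner.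

Definition eps_in (a : R) : S := (a, 0).
Definition eps : S := (0, 1).

Lemma eps_in_zmod : zmod_morphism eps_in.
Proof. by move=> a b; congr pair; rewrite /= subr0. Qed.
Lemma eps_in_monoid : monoid_morphism eps_in.
Proof. by split=> // a b; congr pair; rewrite /=; ring. Qed.

HB.instance Definition _ := GRing.isZmodMorphism.Build R S eps_in eps_in_zmod.
HB.instance Definition _ := GRing.isMonoidMorphism.Build R S eps_in eps_in_monoid.

Lemma eps_sq : eps * eps = eps_in t * eps.
Proof. by congr pair; rewrite /=; ring. Qed.

(** This replaces the division by 1 - q: it holds for every t, including t = 0, where eps is
    nilpotent. *)
Lemma eps_mul_in_eq0 (a : R) : eps * eps_in a = 0 -> a = 0.
Proof. by move/(congr1 snd); rewrite /= mul0r mul1r add0r !mulr0 addr0. Qed.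

End EpsRing.

(** * Words, comajor index and removal of the last letter *)

Section Words.
Variables (n : nat).
Implicit Types (a b : seq 'I_n) (w v : 'S_n).

(** The default 0 for the empty word is harmless in [comaj_rcons], where the ascent it may create
    has weight 0. *)
Definition last_letter a : nat := last 0%N (map val a).

Lemma last_letter_rcons a i : last_letter (rcons a i) = i.
Proof. by rewrite /last_letter map_rcons last_rcons. Qed.

Lemma comaj_rcons a i :
  comaj (rcons a i) = (comaj a + (last_letter a < i) * size a)%N.
Proof.
rewrite /comaj size_rcons /=; case: (lastP a) => [|b j].
  by rewrite !big_ord0 muln0.
rewrite size_rcons /= big_mkcond big_ord_recr /= -big_mkcond /=.
rewrite last_letter_rcons !map_rcons !nth_rcons !size_rcons !size_map !ltnn ltnSn !eqxx.
congr (_ + _)%N; last by case: (_ < _)%N; rewrite ?mul1n ?mul0n.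
apply: eq_bigl => l; rewrite !nth_rcons !size_rcons !size_map.
by rewrite !ltnS !(ltnW (ltn_ord l)) (ltn_ord l).
Qed.

Lemma wordperm_rcons a i : wordperm (rcons a i) = (sref i * wordperm a)%g.
Proof.
rewrite /wordperm; elim: a => [|j a IH] /=; first by rewrite mul1g mulg1.
by rewrite IH mulgA.
Qed.

Lemma valid_word_rcons a i : valid_word (rcons a i) = (i.+1 < n)%N && valid_word a.
Proof. by rewrite /valid_word all_rcons. Qed.

Lemma perm_length_wordperm a :
  valid_word a -> (perm_length (wordperm a) <= size a)%N.
Proof.
elim/last_ind: a => [|a i IH]; first by rewrite perm_length1.
rewrite valid_word_rcons wordperm_rcons size_rcons => /andP[lt_i /IH le_a].
have [lt|gt|/val_inj/perm_inj/(congr1 val)] := ltngtP (wordperm a i) (wordperm a (nextpos i)).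
- by rewrite perm_length_asc.
- by move: le_a; rewrite (perm_length_desc n _ i) //; lia.
by rewrite /= nextposE //; lia.
Qed.

Variables (R : comNzRingType) (q : R) (U : nat -> R).

(** Reducedness is encoded by the length: for L the length of w, the words summed are the reduced
    ones. *)
Definition wordsum (L : nat) (P : pred nat) (w : 'S_n) : R :=
  \sum_(a : L.-tuple 'I_n | valid_word a && (wordperm a == w) && P (last_letter a))
     q ^+ comaj a * \prod_(i <- a) U i.

Lemma wordsum_split L (P Q : pred nat) w :
  wordsum L P w = wordsum L (fun l => P l && Q l) w + wordsum L (fun l => P l && ~~ Q l) w.
Proof.
rewrite /wordsum (bigID (fun a : L.-tuple 'I_n => Q (last_letter a))) /=.
by congr (_ + _); apply: eq_bigl => a; rewrite !andbA.
Qed.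

Lemma eq_wordsum L (P Q : pred nat) w : P =1 Q -> wordsum L P w = wordsum L Q w.
Proof. by move=> PQ; apply: eq_bigl => a; rewrite PQ. Qed.

(** Deleting the final i leaves a word of length L for w s_i; restoring it adds L to the comajor
    index exactly when the preceding letter is below i. The equality case joins the second sum
    because reduced words have no repeated adjacent letter. *)
Lemma wordsum_last L (i : 'I_n) w : perm_length w = L.+1 ->
  wordsum L.+1 (fun l => l == i) w = if descent n w i then
    U i * (wordsum L (fun l => i < l)%N (sref i * w)%g
         + q ^+ L * wordsum L (fun l => l <= i)%N (sref i * w)%g) else 0.
Proof.
move=> len_w; rewrite /wordsum.
pose h (b : L.-tuple 'I_n) : L.+1.-tuple 'I_n := [tuple of rcons b i].
pose h' (a : L.+1.-tuple 'I_n) : L.-tuple 'I_n := [tuple of belast (thead a) (behead a)].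
rewrite (reindex_onto h h') => [|a]; last first.
  case/andP=> _ /eqP la; apply: val_inj => /=.
  move: la; case/tupleP: a => x a; rewrite theadE /= lastI => la; congr rcons.
  by apply: val_inj; rewrite /= -la last_letter_rcons.
have hK (b : L.-tuple 'I_n) : h' (h b) = b.
  have := congr1 val (tuple_eta (h b)); rewrite /= lastI => /rcons_inj[E _].
  exact/val_inj.
have -> : \sum_(b | valid_word (h b) && (wordperm (h b) == w) && (last_letter (h b) == i)
     && (h' (h b) == b)) q ^+ comaj (h b) * \prod_(j <- h b) U j
   = \sum_(b : L.-tuple 'I_n | (i.+1 < n)%N && (valid_word b && (wordperm b == sref i * w)%g))
     U i * (q ^+ (comaj b + (last_letter b < i) * L) * \prod_(j <- b) U j).
  apply: eq_big => [b|b _].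
    rewrite hK eqxx andbT /= last_letter_rcons eqxx andbT valid_word_rcons -andbA.
    by rewrite wordperm_rcons -(inj_eq (mulgI (sref i))) srefK.
  rewrite /= big_rcons /= comaj_rcons size_tuple.
  by rewrite mulrA mulrC.
case: ifP => [|ndw]; last first.
  apply: big1 => b /and3P[lt_i vb /eqP wb].
  move: ndw; rewrite descent_ord lt_i /= => /negbT; rewrite -leqNgt leq_eqVlt.
  case/predU1P => [/val_inj/perm_inj/(congr1 val)|asc]; first by rewrite /= nextposE //; lia.
  (* At an ascent w s_i would have length L+2, too long for a word of L letters. *)
  by have := perm_length_wordperm _ vb; rewrite wb perm_length_asc // len_w size_tuple; lia.
rewrite descent_ord => /andP[lt_i dw].
rewrite lt_i -big_distrr /=; congr (_ * _).
rewrite big_distrr /= (bigID (fun b : L.-tuple 'I_n => (i < last_letter b)%N)) /=.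
congr (_ + _).
  apply: eq_bigr => b /andP[_ lt_b]; congr (q ^+ _ * _).
  by rewrite ltnNge ltnW //= addn0.
apply: eq_big => [b|b /andP[/andP[vb /eqP wb] le_b]]; first by rewrite -leqNgt.
rewrite mulrA -exprD; congr (q ^+ _ * _); rewrite addnC; congr (_ + _)%N.
rewrite -leqNgt leq_eqVlt in le_b; case/predU1P: le_b => [lb|->]; last by rewrite mul1n.
(* If a nonempty b ended in i, cancelling s_i would express w by L-1 letters; for the empty b both
   weights are 1. *)
suff L0 : L = 0%N by rewrite L0 in b vb wb lb *; rewrite muln0.
have sb := size_tuple b; move: wb vb lb sb.
case: (lastP b) => [|c j] /=; first by move=> _ _ _ <-.
rewrite wordperm_rcons valid_word_rcons last_letter_rcons size_rcons.
move=> + /andP[lt_j vc] /val_inj ji; rewrite ji => /mulgI wc.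
by have := perm_length_wordperm _ vc; rewrite wc len_w; lia.
Qed.

End Words.

(** * The fixed point equation and its unique solution *)

Section Core.
Variables (k : fieldType) (q : k).
Hypothesis qint_neq0 : forall i, qint q i.+1 != 0.

Lemma qintS i : qint q i.+1 = 1 + q * qint q i.
Proof.
rewrite /qint big_ord_recl expr0 big_distrr /=; congr (_ + _).
by apply: eq_bigr => j _; rewrite -exprS.
Qed.

Lemma qfactS l : qfact q l.+1 = qfact q l * qint q l.+1.
Proof. by rewrite /qfact big_ord_recr. Qed.

Variables (n : nat) (R : comNzRingType) (kappa : {rmorphism k -> R}).
Variable x : nat -> R.
Variable t : R.
Hypothesis tE : t = 1 - kappa q.
Local Notation S := (epsring R t).
Local Notation io := (eps_in R t).
Local Notation ep := (eps R t : S).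
Local Notation s := (1 - ep).
Local Notation d := #|{: 'S_n}|.
Local Notation U := (fun i => \sum_(j < i.+1) x j).
Hypothesis klyachko : forall m, (m < n)%N -> U m * x m.+1 = U m * (kappa q * x m).

Lemma eps_s : ep * s = io (kappa q) * ep.
Proof.
rewrite mulrBr mulr1 eps_sq -{1}[ep]mul1r -mulrBl; congr (_ * _).
rewrite -(rmorph1 io) -(rmorphB io); congr (io _).
by rewrite tE opprB addrC subrK.
Qed.

Lemma eps_s_expr l : ep * s ^+ l = io (kappa q) ^+ l * ep.
Proof.
elim: l => [|l IH]; first by rewrite !expr0 mulr1 mul1r.
by rewrite exprSr mulrA IH -mulrA eps_s mulrA -exprSr.
Qed.

Lemma one_sub_s_expr l : 1 - s ^+ l = ep * io (kappa (qint q l)).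
Proof.
elim: l => [|l IH]; first by rewrite expr0 subrr /qint big_ord0 !rmorph0 mulr0.
have -> : 1 - s ^+ l.+1 = ep + s * (1 - s ^+ l) by rewrite exprS; ring.
rewrite IH mulrA [s * _]mulrC eps_s qintS.
rewrite (rmorphD kappa) (rmorph1 kappa) (rmorphM kappa) (rmorphD io) (rmorph1 io).
by rewrite (rmorphM io) mulrDr mulr1 [in RHS]mulrCA mulrA.
Qed.

Lemma eps_in_klyachko m : (m < n)%N ->
  (1 - s) * (\sum_(i < m.+1) io (x i)) * io (x m.+1) =
  (1 - s) * (\sum_(i < m.+1) io (x i)) * (s * io (x m)).
Proof.
move=> mn; rewrite opprB addrC subrK -(rmorph_sum io) -[LHS]mulrA.
rewrite -(rmorphM io) klyachko // !rmorphM.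
by rewrite [RHS]mulrACA eps_s; ring.
Qed.

Definition scaled (f : 'rV[R]_d) : 'rV[S]_d := map_mx io f *m lenmx n S s.

(** The recursion on length as a linear equation, satisfied by both sides of the formula; its
    solutions are determined by their coefficients in length 0. *)
Definition fixedpoint (f : 'rV[R]_d) : Prop :=
  scaled f *m hprod S d (Tmx n S) s (fun i => io (x i)) n = map_mx io f.

Lemma coef_map (f : 'rV[R]_d) w : coef n S (map_mx io f) w = io (coef n R f w).
Proof. by rewrite /coef mxE. Qed.

Lemma coef_scaled f w : coef n S (scaled f) w = io (coef n R f w) * s ^+ perm_length w.
Proof. by rewrite coef_lenmx coef_map. Qed.

Lemma fixedpoint_sub f g : fixedpoint f -> fixedpoint g -> fixedpoint (f - g).
Proof.
rewrite /fixedpoint /scaled => ff fg.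
by rewrite !map_mxB !mulmxBl ff fg.
Qed.

Lemma coef_hprod_lowest (y : nat -> S) (f : 'rV[S]_d) L m w :
  (forall v, (perm_length v < L)%N -> coef n S f v = 0) ->
  (perm_length w <= L)%N ->
  coef n S (f *m hprod S d (Tmx n S) s y m) w = coef n S f w.
Proof.
elim: m f w => [|m IHm] f w f0 le_w; first by rewrite mulmx1.
have E v : (perm_length v <= L)%N ->
    coef n S (f *m hfac S d (Tmx n S) m ((1 - s) * \sum_(i < m.+1) y i)) v = coef n S f v.
  move=> le_v; rewrite coef_hfac; case: ifP => [dv|_]; last by rewrite mulr0 addr0.
  rewrite (f0 (nsref n m * v)%g) ?mulr0 ?addr0 //.
  by move: le_v; rewrite (descent_length _ _ _ dv).
by rewrite /= row_mulA IHm ?E // => v lt_v; rewrite E ?f0 // ltnW.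
Qed.

(* At the lowest length in the support the factors h_j act trivially, so the
   equation reduces there to (1 - s^l) f(w) = 0. *)
Lemma fixedpoint_eq0 f : fixedpoint f ->
  (forall w, perm_length w = 0%N -> coef n R f w = 0) -> f = 0.
Proof.
move=> fixf f0; apply: coefP => w; rewrite [RHS]mxE.
have [L] := ubnP (perm_length w); elim: L w => // L IHL w; rewrite ltnS => le_w.
have low v : (perm_length v < perm_length w)%N -> coef n S (scaled f) v = 0.
  by move=> lt_v; rewrite coef_scaled IHL ?rmorph0 ?mul0r // (leq_trans lt_v).
case def_l : (perm_length w) => [|l]; first exact: f0.
have := congr1 (coef n S ^~ w) fixf; rewrite /= (coef_hprod_lowest _ _ _ _ _ low) //.
rewrite coef_scaled coef_map => /esym/eqP; rewrite -subr_eq0 -{1}[io _]mulr1 -mulrBr.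
rewrite one_sub_s_expr def_l mulrCA -rmorphM => /eqP/eps_mul_in_eq0.
move/(congr1 (fun z => z * kappa (qint q l.+1)^-1)).
by rewrite mul0r -mulrA -rmorphM mulfV ?qint_neq0 // rmorph1 mulr1.
Qed.

Lemma fixedpoint_schubval : fixedpoint (delta1 n R *m serprod R d n (Tmx n R) n x).
Proof.
rewrite /fixedpoint /scaled map_mxM map_serprod.
have dE : map_mx io (delta1 n R) = delta1 n S.
  by apply/matrixP => a b; rewrite !mxE rmorph_nat.
apply: coefP => w; rewrite dE [RHS](schubval_fixpoint n S s) //; last first.
  exact: eps_in_klyachko.
(* By homogeneity, scaling the coefficients by length is scaling the arguments by s. *)
rewrite -[in LHS](row_mulA _ _ (delta1 n S)) serprod_lenmx row_mulA.
congr (coef n S (_ *m _ *m _) w); apply: coefP => v; rewrite coef_lenmx coef_delta1.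
by case: eqP => [->|_]; rewrite ?mul0r // perm_length1 mulr1.
Qed.

Local Notation wsum L P w := (wordsum n R (kappa q) U L P w).

Definition wordvec : 'rV[R]_d := \row_a
  (kappa (qfact q (perm_length (enum_val a)))^-1 *
   wsum (perm_length (enum_val a)) predT (enum_val a)).

(* The value of the product of the vector of weighted word sums by
   h_{n-1}, ..., h_j: it is carried by the last letter alone. *)
Definition partvec (j : nat) : 'rV[S]_d := \row_a
  (let w := enum_val a in let L := perm_length w in
   io (kappa (qfact q L)^-1) *
   (io (wsum L (fun l => j <= l)%N w) + s ^+ L * io (wsum L (fun l => l < j)%N w))).

Lemma coef_partvec j w : coef n S (partvec j) w =
  io (kappa (qfact q (perm_length w))^-1) *
   (io (wsum (perm_length w) (fun l => j <= l)%N w)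
    + s ^+ perm_length w * io (wsum (perm_length w) (fun l => l < j)%N w)).
Proof. by rewrite /coef mxE /= enum_rankK. Qed.

Lemma coef_wordvec w : coef n R wordvec w =
  kappa (qfact q (perm_length w))^-1 * wsum (perm_length w) predT w.
Proof. by rewrite /coef mxE /= enum_rankK. Qed.

(** Words ending in j gain (1 - s^L) = eps [L]_q times their sum. By [wordsum_last] this is eps
    u_{j+1} times a sum over w s_j: [L]_q cancels in the factorial, and eps s^(L-1) = eps q^(L-1)
    matches the weights. *)
Lemma partvec_step j : (j < n)%N ->
  partvec j.+1 *m hfac S d (Tmx n S) j ((1 - s) * \sum_(i < j.+1) io (x i)) = partvec j.
Proof.
move=> jn; apply: coefP => w; rewrite coef_hfac.
have jE : j = val (Ordinal jn) by [].
set L := perm_length w.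
have Ege : wsum L (fun l => j <= l)%N w =
    wsum L (fun l => j < l)%N w + wsum L (fun l => l == j) w.
  rewrite (wordsum_split _ _ _ _ _ _ (fun l => j < l)%N).
  by congr (_ + _); apply: eq_wordsum => l /=; lia.
have Elt : wsum L (fun l => l < j.+1)%N w =
    wsum L (fun l => l < j)%N w + wsum L (fun l => l == j) w.
  rewrite (wordsum_split _ _ _ _ _ _ (fun l => l < j)%N).
  by congr (_ + _); apply: eq_wordsum => l /=; lia.
rewrite [coef n S (partvec _) w]coef_partvec.
rewrite [coef n S (partvec j) w]coef_partvec -/L Ege Elt !(rmorphD io).
set A := wsum L (fun l => j < l)%N w; set B := wsum L (fun l => l < j)%N w.
set C := wsum L (fun l => l == j) w.
set Y := (if descent n w j then _ else _).
suff E : (1 - s) * (\sum_(i < j.+1) io (x i)) * Y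
   = io (kappa (qfact q L)^-1) * ((1 - s ^+ L) * io C).
  rewrite E; ring.
rewrite one_sub_s_expr -(rmorph_sum io) opprB addrC subrK {}/Y.
case def_L: L => [|L'].
  rewrite /qint big_ord0 (rmorph0 kappa) (rmorph0 io) mulr0 mul0r mulr0.
  case: ifP => [dw|_]; last by rewrite mulr0.
  by have := descent_length _ _ _ dw; rewrite -/L def_L.
have CE : C = if descent n w j then U j * (wsum L' (fun l => j < l)%N (nsref n j * w)%g
         + kappa q ^+ L' * wsum L' (fun l => l <= j)%N (nsref n j * w)%g) else 0.
  by rewrite /C def_L jE (wordsum_last _ _ _ _ _ (Ordinal jn)) ?nsref_ord.
rewrite CE; case: ifP => [dw|_]; last by rewrite (rmorph0 io) !mulr0.
have len_v : perm_length (nsref n j * w)%g = L'.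
  by apply: eq_add_S; rewrite -(descent_length _ _ _ dw).
rewrite coef_partvec len_v qfactS invfM (rmorphM kappa) (rmorphM io).
rewrite (rmorphM io (U j)) (rmorphD io) (rmorphM io (kappa q ^+ L')) (rmorphXn io).
set a := io (wsum _ _ _); set b := io (wsum _ _ _).
have unit_q : io (kappa (qint q L'.+1)^-1) * io (kappa (qint q L'.+1)) = 1.
  by rewrite -(rmorphM io) -(rmorphM kappa) mulVf ?qint_neq0 // (rmorph1 kappa) (rmorph1 io).
have es := eps_s_expr L'.
transitivity (io (U j) * io (kappa (qfact q L')^-1) * (ep * a + (ep * s ^+ L') * b)).
  ring.
rewrite es.
transitivity ((io (kappa (qint q L'.+1)^-1) * io (kappa (qint q L'.+1))) *
  (io (U j) * io (kappa (qfact q L')^-1) * (ep * a + (io (kappa q) ^+ L' * ep) * b))).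
  by rewrite unit_q mul1r.
ring.
Qed.

Lemma fixedpoint_wordvec : fixedpoint wordvec.
Proof.
rewrite /fixedpoint; have -> : scaled wordvec = partvec n.
  apply: coefP => w; rewrite coef_scaled coef_wordvec coef_partvec.
  set L := perm_length w; rewrite (rmorphM io) -mulrA; congr (_ * _).
  rewrite (wordsum_split _ _ _ _ _ predT (fun l => l < n)%N) /= (rmorphD io).
  rewrite (eq_wordsum _ _ _ _ _ (fun l => ~~ (l < n)%N) (fun l => n <= l)%N); last first.
    by move=> l /=; rewrite -leqNgt.
  rewrite mulrDl addrC [in RHS]mulrC; congr (_ + _).
  (* For the empty word the default last letter 0 is not below n when n = 0, but s^0 = 1 makes both
     weights agree. *)
  case: L => [|L]; first by rewrite mulr1.
  rewrite (_ : wsum _ _ _ = 0) ?(rmorph0 io) ?mul0r // /wordsum big_pred0 // => a.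
  apply/negbTE; rewrite negb_and orbC -ltnNge /last_letter.
  by case/tupleP: a => y a /=; rewrite (last_map val) ltn_ord.
have -> : map_mx io wordvec = partvec 0.
  apply: coefP => w; rewrite coef_map coef_wordvec coef_partvec (rmorphM io).
  rewrite (_ : wsum _ (fun l => l < 0)%N w = 0) ?(rmorph0 io) ?mulr0 ?addr0 //.
  by rewrite /wordsum big_pred0 // => a; rewrite ltn0 andbF.
have chain m : (m <= n)%N ->
    partvec m *m hprod S d (Tmx n S) s (fun i => io (x i)) m = partvec 0.
  elim: m => [|m IHm] mn; first by rewrite mulmx1.
  by rewrite /= row_mulA partvec_step // IHm // ltnW.
exact: chain.
Qed.

Lemma schubval_wordsum w : schubval n R x w =
  kappa (qfact q (perm_length w))^-1 * wsum (perm_length w) predT w.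
Proof.
rewrite -coef_wordvec /schubval; congr (coef n R _ w); apply/eqP.
rewrite -subr_eq0; apply/eqP/fixedpoint_eq0.
  exact: fixedpoint_sub fixedpoint_schubval fixedpoint_wordvec.
move=> v len_v.
have -> (f g : 'rV[R]_d) : coef n R (f - g) v = coef n R f v - coef n R g v.
  by rewrite /coef !mxE.
rewrite coef_wordvec len_v /qfact big_ord0 invr1 (rmorph1 kappa) mul1r.
apply/eqP; rewrite subr_eq0; apply/eqP.
(* In degree 0 the arguments may be set to 0, which turns the product into 1. *)
transitivity (schubval n R (fun i => 0 * x i) v).
  by rewrite schubval_scale len_v expr0 mul1r.
have ser0 i : ser R d n (Tmx n R) i 0 = 1.
  elim/(down_ind n): i => [i ni|i IH]; first by rewrite ser_big.
  by rewrite (serS _ _ _ _ (T_big n R)) IH hfac0 mulr1.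
rewrite /schubval (_ : serprod _ _ _ _ _ _ = 1) ?mulmx1; last first.
  by apply: big1 => i _; rewrite mul0r ser0.
rewrite coef_delta1 /wordsum big_mkcond (big_pred1 [tuple]) => [|a]; last first.
  by rewrite [a]tuple0; apply/esym/eqP.
by rewrite /= andbT /comaj big_ord0 big_nil mulr1 expr0 eq_sym; case: eqP.
Qed.

End Core.

(** * The quotient ring *)

Section IdealQuotient.
Variables (P : comNzRingType) (I : P -> Prop).
Hypotheses (I0 : I 0) (I1 : ~ I 1)
  (ID : forall a u v, I u -> I v -> I (a * u + v)).

(** Membership is an existential statement; excluded middle makes it the boolean predicate that the
    quotient construction takes. *)
Definition idealb (p : P) : bool :=
  if excluded_middle_informative (I p) then true else false.

Lemma idealbP p : reflect (I p) (idealb p).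
Proof. by rewrite /idealb; case: excluded_middle_informative => Ip; constructor. Qed.

Lemma idealb_closed : idealr_closed idealb.
Proof.
split; [exact/idealbP | exact/idealbP |].
by move=> a u v /idealbP Iu /idealbP Iv; apply/idealbP/ID.
Qed.

HB.instance Definition _ := isIdealr.Build P idealb idealb_closed.

Lemma ideal_quotient : exists (Q : comNzRingType) (pi : {rmorphism P -> Q}),
  forall p, pi p = 0 <-> I p.
Proof.
pose J : idealr P := idealb.
exists {ideal_quot J}, (\pi_({ideal_quot J})%qT : {rmorphism P -> {ideal_quot J}}) => p.
pose piJ : {rmorphism P -> {ideal_quot J}} := \pi_({ideal_quot J})%qT.
have E : (piJ p = 0) <-> (p \in J).
  rewrite -[p in p \in J]subr0 Quotient.idealrBE.
  by rewrite -[0 in X in X <-> _](rmorph0 piJ); split=> /eqP.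
by split=> [/E/idealbP | /idealbP/E].
Qed.

End IdealQuotient.

(** * The ideal defining the quotient of the Klyachko algebra *)

Section KlyachkoQuotient.
Variables (k : fieldType) (q : k) (M : nat).
Local Notation P := {mpoly k[(M + M).+1]}.
Local Notation I := (Kplus_ideal (M := M) q).

Lemma Kplus_ideal0 : I 0.
Proof.
exists (fun=> 0), (fun=> 0); rewrite big1 // => j _.
by rewrite !mul0r !if_same addr0.
Qed.

Lemma Kplus_idealD (a u v : P) : I u -> I v -> I (a * u + v).
Proof.
move=> [c [e ->]] [c' [e' ->]].
exists (fun i => a * c i + c' i), (fun i => a * e i + e' i).
rewrite big_distrr -big_split /=; apply: eq_bigr => j _.
by case: ifP => _; case: ifP => _; ring.
Qed.

Lemma meval0_Kvar i : (Kvar k M i).@[fun=> 0] = 0.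
Proof. by rewrite /Kvar; case: ifP => _; rewrite ?mevalXU ?meval0. Qed.

(** All generators vanish when every variable is set to 0. *)
Lemma Kplus_ideal1 : ~ I 1.
Proof.
move=> [c [e /(congr1 (meval (fun=> 0)))]]; rewrite meval1 raddf_sum /= big1.
  by move/eqP; rewrite oner_eq0.
move=> j _; rewrite mevalD /Krel.
case: ifP => _; case: ifP => _; rewrite ?meval0 ?mevalM ?mevalB ?mevalZ ?mevalD ?mevalZ
  ?rmorphXn /= ?mevalM ?meval0_Kvar; ring.
Qed.

Lemma Kplus_ideal_gen (g : int -> P) (b : int -> bool) i :
  (forall c : int -> P, I (\sum_(j < (M + M).+1)
      (if b (j%:Z - M%:Z) then c (j%:Z - M%:Z) * g (j%:Z - M%:Z) else 0))) ->
  b i -> - M%:Z <= i <= M%:Z -> I (g i).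
Proof.
move=> Ic bi /andP[geM leM].
have lt_j : (absz (i + M%:Z)%R < (M + M).+1)%N by lia.
have ij : (Ordinal lt_j : nat)%:Z - M%:Z = i by rewrite /=; lia.
have := Ic (fun l : int => if l == i then 1 else 0).
rewrite (bigD1 (Ordinal lt_j)) //= ij bi eqxx mul1r.
rewrite big1 ?addr0 // => j /eqP nj; case: ifP => // _.
case: eqP => [E|_]; last by rewrite mul0r.
case: nj.
by apply: val_inj; rewrite /=; lia.
Qed.

Lemma Kplus_ideal_Krel i : (absz i < M)%N -> I (Krel q M i).
Proof.
move=> iM; apply: (Kplus_ideal_gen _ (fun i => absz i < M)%N) => // [c|]; last by lia.
exists c, (fun=> 0); apply: eq_bigr => j _.
by rewrite mul0r if_same addr0.
Qed.

Lemma Kplus_ideal_Kvar i : - M%:Z <= i -> i <= 0 -> I (Kvar k M i).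
Proof.
move=> geM le0; apply: (Kplus_ideal_gen _ (fun i => i <= 0)) => // [c|]; last by lia.
exists (fun=> 0), c; apply: eq_bigr => j _.
by rewrite mul0r if_same add0r.
Qed.

End KlyachkoQuotient.

(** * Conclusion in the Klyachko algebra *)

Lemma qint_neq0 (k : fieldType) (q : k) : [pchar k] =i pred0 ->
  (forall m : nat, (0 < m)%N -> q ^+ m = 1 -> q = 1) -> forall i, qint q i.+1 != 0.
Proof.
move=> char0 q_not_root i; case: (eqVneq q 1) => [->|q1].
  rewrite /qint (eq_bigr (fun=> 1)) => [|j _]; last by rewrite expr1n.
  by rewrite sumr_const card_ord; move/(pcharf0P k): char0 => ->.
apply/eqP => qi; move/eqP: q1; apply; apply: (q_not_root i.+1) => //.
by apply/eqP; rewrite -subr_eq0 subrX1 -/(qint _ _) qi mulr0.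
Qed.

Theorem theorem1p4 (k : fieldType) (q : k)
  (char0 : [pchar k] =i pred0)
  (q_not_root : forall m : nat, (0 < m)%N -> q ^+ m = 1 -> q = 1)
  (n : nat) (w : 'S_n) :
  Kplus_eq q
    (fun M => schubert k w \mPo usubst k n M)
    (fun M => (qfact q (perm_length w))^-1 *:
        \sum_(a : (perm_length w).-tuple 'I_n | valid_word a && (wordperm a == w))
           q ^+ comaj a *: \prod_(i <- a) Kvar k M (i.+1)%:Z)
    n.
Proof.
(* The relations at 1, ..., n are used, and the window M contains those of index below M. *)
exists n.+1; split=> //; set M := n.+1.
have [Q [pi piP]] := ideal_quotient _ _ (Kplus_ideal0 k q M) (Kplus_ideal1 k q M)
  (Kplus_idealD k q M).
apply/piP; rewrite rmorphB; apply/eqP; rewrite subr_eq0; apply/eqP.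
pose kappa : {rmorphism k -> Q} := (pi \o @mpolyC _ _).
pose K i := pi (Kvar k M i).
have K0 : K 0 = 0 by apply/piP/Kplus_ideal_Kvar.
pose x i := K i.+1%:Z - K i%:Z.
have Ux m : \sum_(j < m.+1) x j = K m.+1%:Z.
  elim: m => [|m IHm]; first by rewrite big_ord1 /x K0 subr0.
  by rewrite big_ord_recr /= IHm /x addrC subrK.
(* The defining relation rearranged as u_i (u_{i+1} - u_i) = q u_i (u_i - u_{i-1}), with i = m+1. *)
have klyachko m : (m < n)%N -> (\sum_(j < m.+1) x j) * x m.+1
    = (\sum_(j < m.+1) x j) * (kappa q * x m).
  move=> mn; have /piP : Kplus_ideal q (Krel q M m.+1) by apply: Kplus_ideal_Krel; lia.
  rewrite /Krel -!mul_mpolyC expr2.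
  have -> : m.+1%:Z - 1 = m%:Z by lia.
  have -> : m.+1%:Z + 1 = m.+2%:Z by lia.
  rewrite (rmorphB pi) (rmorphD pi) !(rmorphM pi) mpolyCD (rmorphD pi).
  rewrite -!/(K _) (_ : pi 1%:MP = 1) ?(rmorph1 pi) //.
  rewrite (_ : pi q%:MP = kappa q) // Ux /x => E.
  apply/eqP; rewrite -subr_eq0 -oppr_eq0 -E; apply/eqP; ring.
rewrite schubert_schubval (map_schubval _ _ _ (comp_mpoly (usubst k n M))).
rewrite (map_schubval _ _ _ pi); transitivity (schubval n Q x w).
  rewrite /schubval /serprod; congr (coef _ _ (_ *m _) _); apply: eq_bigr => i _.
  rewrite xvar_ord /= comp_mpolyXU -tnth_nth tnth_mktuple /x; congr (ser _ _ _ _ _ _).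
  case: eqP => [->|_]; last by rewrite rmorphB.
  by rewrite K0 subr0.
rewrite (schubval_wordsum _ _ (qint_neq0 _ _ char0 q_not_root) _ _ kappa _ _ (erefl _) klyachko).
have kappaE c p : pi (c *: p) = kappa c * pi p by rewrite -mul_mpolyC (rmorphM pi).
rewrite kappaE; congr (_ * _); rewrite /wordsum rmorph_sum /=.
apply: eq_big => [a|a _]; first by rewrite andbT.
rewrite kappaE -(rmorphXn kappa) rmorph_prod; congr (_ * _).
by apply: eq_bigr => i _; rewrite Ux.
Qed.
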